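(* Let $\mathbb{K}$ be a field and let $G$ be any finite simple graph with vertex set $V(G)=\{x_1,\ldots,x_n\}$. Let $R=\mathbb{K}[x_1,\ldots,x_n]$, let $NI(G)\subseteq R$ be the closed neighborhood ideal of $G$, and let $a_G$ be the matching number of $G$. Then $\mathrm{reg}(R/NI(G))\ge a_G$.
   Context: For a vertex $w$ of $G$, $N_G[w]$ denotes the closed neighborhood of $w$, i.e. $w$ together with all vertices adjacent to $w$. The vertices of $G$ are identified with the variables of the polynomial ring $R=\mathbb{K}[x_1,\ldots,x_n]$ (standard grading, each variable of degree 1). For $w\in V(G)$ put $m_{(G,w)}=\prod_{x_i\in N_G[w]}x_i$. The closed neighborhood ideal is $NI(G)=\langle m_{(G,w)} : w\in V(G)\rangle$. A matching of $G$ is a set of pairwise disjoint edges; the matching number $a_G$ is the maximum size of a matching. For a monomial ideal $I\subseteq R$, $\mathrm{reg}(R/I)=\max\{j-i:\beta_{i,j}(R/I)\neq 0\}$ is the Castelnuovo-Mumford regularity, where $\beta_{i,j}(R/I)$ are the graded Betti numbers in the graded minimal free resolution of $R/I$ over $R$. *)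

(* Defs.v *)
From HB Require Import structures.
From mathcomp Require Import all_boot all_order all_algebra.
From mathcomp.multinomials Require Export mpoly.

Set Implicit Arguments.
Unset Strict Implicit.
Unset Printing Implicit Defensive.

Import Order.TTheory GRing.Theory Num.Theory.
Local Open Scope ring_scope.

(* A simple graph is a symmetric irreflexive relation on its vertex set;
   here the vertex set is 'I_n, the index set of the variables. *)
Section Graph.

Variable T : finType.
Implicit Types (e : rel T) (M : {set {set T}}).

Definition edges e : {set {set T}} :=
  [set A | [exists x, exists y, e x y && (A == [set x; y])]].

Definition is_matching e M : bool := (M \subset edges e) && trivIset M.

Definition matching_number e : nat := \max_(M | is_matching e M) #|M|.

Definition closed_nbhd e (w : T) : {set T} := [set x | (x == w) || e w x].

End Graph.

Section ClosedNeighborhoodIdeal.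

Variables (K : fieldType) (n : nat).
Local Notation R := {mpoly K[n]}.

Definition ideal_gen (I : finType) (g : I -> R) (p : R) : Prop :=
  exists c : I -> R, p = \sum_i c i * g i.

Definition closed_nbhd_mon (e : rel 'I_n) (w : 'I_n) : R :=
  \prod_(i in closed_nbhd e w) 'X_i.

Definition closed_nbhd_ideal (e : rel 'I_n) : R -> Prop :=
  ideal_gen (closed_nbhd_mon e).

End ClosedNeighborhoodIdeal.

Arguments closed_nbhd_mon K {n} e w.
Arguments closed_nbhd_ideal K {n} e p.

Section Regularity.

Variables (K : fieldType) (n : nat).
Local Notation R := {mpoly K[n]}.

(* Homogeneity of integer degree: only 0 has negative degree, and 0 has every
   degree. *)
Definition homog_of_deg (d : int) (p : R) : bool :=
  match d with
  | Posz m => p \is m.-homog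
  | Negz _ => p == 0
  end.

(* The data  ... -> F_2 -> F_1 -> F_0 -> R/I  where
     F_i = \bigoplus_(k < fr_rank i) R(- fr_deg i k)
   is represented by row vectors, so that its k-th basis element has degree
   fr_deg i k.  The map F_{i+1} -> F_i is u |-> u *m fr_diff i, and the map
   F_0 -> R/I is the class modulo I of the entry of u *m fr_aug. *)
Record free_complex := FreeComplex {
  fr_rank : nat -> nat;
  fr_deg  : forall i, 'I_(fr_rank i) -> int;
  fr_diff : forall i, 'M[R]_(fr_rank i.+1, fr_rank i);
  fr_aug  : 'cV[R]_(fr_rank 0)
}.

Record graded_min_free_resolution (I : R -> Prop) (F : free_complex) : Prop :=
  GradedMinFreeResolution {
  gmfr_diff_homog : forall i k l,
    homog_of_deg (fr_deg k - fr_deg l) (fr_diff F i k l);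
  gmfr_aug_homog : forall k, homog_of_deg (fr_deg k) (fr_aug F k 0);
  gmfr_surj : forall p : R,
    exists u : 'rV[R]_(fr_rank F 0), I (p - (u *m fr_aug F) 0 0);
  gmfr_exact0 : forall u : 'rV[R]_(fr_rank F 0),
    I ((u *m fr_aug F) 0 0) <-> exists v, u = v *m fr_diff F 0;
  gmfr_exact : forall i (u : 'rV[R]_(fr_rank F i.+1)),
    u *m fr_diff F i = 0 <-> exists v, u = v *m fr_diff F i.+1;
  (* the differentials have entries in the irrelevant ideal (x_1, ..., x_n) *)
  gmfr_minimal : forall i k l, (fr_diff F i k l)@_0%MM = 0
}.

Definition betti (F : free_complex) (i : nat) (j : int) : nat :=
  #|[set k : 'I_(fr_rank F i) | fr_deg k == j]|.

(* reg(R/I) = r.  The minimal resolution is unique up to isomorphism, so its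
   graded Betti numbers, hence r, depend only on I. *)
Definition is_regularity (I : R -> Prop) (r : int) : Prop :=
  exists F : free_complex,
    [/\ graded_min_free_resolution I F,
        exists i j, betti F i j <> 0%N /\ r = j - i%:Z
      & forall i j, betti F i j <> 0%N -> j - i%:Z <= r].

End Regularity.

(* Main.v *)
(* Let Gamma be the bipartite graph on two copies of V(G) in which inl x and inr y are joined
   iff y lies in N[x].  Swapping the copies is an involution on the independent sets of Gamma
   whose only fixed point is the empty set, so their number is odd and the chain complex of
   Ind(Gamma) cannot be exact.  Two vanishing results would contradict this if the regularity
   were smaller than the matching number a.
   High degrees: each matching edge {x, y} spans a K_{2,2} in Gamma, so Ind(Gamma) is the union
   of the parts avoiding inl x, inl y and inr x, inr y.  Iterating Mayer-Vietoris over the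
   matching leaves sets A, B of demands and variables with min(|A|, |B|) <= (|A| + |B|) / 2,
   which kills homology carried by independent sets of more than n - a vertices.
   Low degrees: homology carried by independent sets of i <= n - a vertices is the squarefree
   part of Tor_i(R/NI(G), K) in degree n (Hochster's formula combined with Alexander duality
   and suspension), which vanishes if reg(R/NI(G)) < a.  The given resolution F computes it
   through the double complex of F and the Koszul complex. *)

From HB Require Import structures.
Require Import Defs.
From mathcomp Require Import all_boot all_order all_algebra.
From mathcomp Require Import zify ring.

Set Implicit Arguments.
Unset Strict Implicit.
Unset Printing Implicit Defensive.

Import Order.TTheory GRing.Theory Num.Theory.
Local Open Scope ring_scope.

(** * The Koszul complex on a finite set of commuting scalars *)

Section KoszulComplex.

Variables (U : finType) (rk : U -> nat).
Hypothesis rk_inj : injective rk.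
Variables (R : comNzRingType) (a : U -> R).

(** The usual exterior sign for the order that [rk] induces: [sgn x S] is the sign of moving e_x
    into its place in e_x ∧ e_S. *)
Definition sgn (x : U) (S : {set U}) : R := (-1) ^+ #|[set y in S | (rk y < rk x)%N]|.

Lemma sgn_setU1 (x y : U) (S : {set U}) : y \notin S ->
  sgn x (y |: S) = (-1) ^+ (rk y < rk x)%N * sgn x S.
Proof.
move=> yS; rewrite /sgn -exprD; congr (_ ^+ _).
case: (boolP (rk y < rk x)%N) => yx; last first.
  apply: eq_card => z; rewrite !inE; case: eqVneq => [->|//].
  by rewrite (negbTE yx) !andbF.
rewrite (_ : [set z in y |: S | _] = y |: [set z in S | (rk z < rk x)%N]).
  by rewrite cardsU1 inE (negbTE yS).
by apply/setP => z; rewrite !inE; case: eqVneq => [->|//]; rewrite yx.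
Qed.

Lemma sgn_sqr (x : U) (S : {set U}) : sgn x S * sgn x S = 1.
Proof. by rewrite -expr2 sqrr_sign. Qed.

(** Exactly one of [x], [y] has the smaller rank, so exactly one of the two orders of insertion
    picks up an extra sign. *)
Lemma sgn_anticomm (x y : U) (S : {set U}) : x != y -> x \notin S -> y \notin S ->
  sgn x S * sgn y (x |: S) = - (sgn y S * sgn x (y |: S)).
Proof.
move=> xy xS yS; rewrite !sgn_setU1 //.
have : rk x != rk y by apply: contra_neq xy => /rk_inj.
rewrite neq_ltn => /orP[lt|lt]; rewrite lt ltnNge (ltnW lt) /=; ring.
Qed.

Section Module.

Variable M : lmodType R.
Implicit Types (c w : {set U} -> M) (S : {set U}).

(* [c S] is the coefficient of the exterior basis element e_S; with [a = 1] this is the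
   augmented simplicial boundary. *)
Definition kos c S : M := \sum_(x | x \notin S) (a x * sgn x S) *: c (x |: S).

(** Exterior multiplication by e_x. *)
Definition cone (x : U) w S : M :=
  if x \in S then sgn x (S :\ x) *: w (S :\ x) else 0.

Lemma eq_kos c w : c =1 w -> kos c =1 kos w.
Proof. by move=> e S; apply: eq_bigr => x _; rewrite e. Qed.

Lemma kosD c w S : kos (fun S' => c S' + w S') S = kos c S + kos w S.
Proof. by rewrite -big_split; apply: eq_bigr => x _; rewrite scalerDr. Qed.

Lemma kosN c S : kos (fun S' => - c S') S = - kos c S.
Proof. by rewrite -sumrN; apply: eq_bigr => x _; rewrite scalerN. Qed.

Lemma kosB c w S : kos (fun S' => c S' - w S') S = kos c S - kos w S.
Proof. by rewrite (kosD c (fun S' => - w S')) kosN. Qed.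

Lemma kosK c S : kos (kos c) S = 0.
Proof.
(* The summand of the double boundary for adding [x] and then [y], extended by zero to all pairs so
   that its antisymmetry can be used. *)
pose H x y : M := if [&& x \notin S, y \notin S & x != y]
  then (a x * sgn x S * (a y * sgn y (x |: S))) *: c (y |: (x |: S)) else 0.
have Hanti x y : H x y = - H y x.
  rewrite /H [y == x]eq_sym andbCA; case: ifP => [/and3P[yS xS xy]|]; last by rewrite oppr0.
  rewrite -scaleNr setUCA; congr (_ *: _).
  have := sgn_anticomm xy xS yS; move: (sgn x S) (sgn y _) (sgn y S) (sgn x _).
  by move=> p q r s e; rewrite mulrACA e; ring.
have -> : kos (kos c) S = \sum_x \sum_y H x y.
  rewrite /kos big_mkcond; apply: eq_bigr => x _; case: ifP => xS; last first.
    by rewrite big1 // => y _; rewrite /H xS.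
  rewrite scaler_sumr big_mkcond; apply: eq_bigr => y _.
  rewrite /H xS /= in_setU1 negb_or [y == x]eq_sym andbC.
  by case: ifP => // _; rewrite scalerA.
(* Pairs with increasing rank cancel against those with decreasing rank. The diagonal is zero by the
   definition of [H], so 2 need not be invertible. *)
rewrite pair_big /= (bigID (fun p => rk p.1 < rk p.2)%N) /=.
rewrite [X in _ + X](bigID (fun p => rk p.2 < rk p.1)%N) /=.
rewrite [X in _ + (_ + X)]big1 ?addr0; last first.
  move=> [x y] /=; rewrite -!leqNgt -eqn_leq => /eqP/rk_inj->.
  by rewrite /H eqxx !andbF.
rewrite -[X in _ + X]opprK -sumrN.
rewrite [X in _ - X](eq_bigl (fun p => rk p.2 < rk p.1)%N); last first.
  by move=> [x y] /=; case: ltngtP.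
rewrite [X in _ - X](eq_bigr (fun p => H p.2 p.1)); last first.
  by move=> [x y] _ /=; rewrite -Hanti.
rewrite [X in _ - X](reindex_inj (h := fun p => (p.2, p.1))) /=; last first.
  by move=> [x y] [x1 y1] /= [-> ->].
by rewrite subrr.
Qed.

(** The homotopy formula: in the boundary of e_x ∧ w, all terms other than the contraction of e_x
    itself anticommute past e_x and cancel. *)
Lemma kos_cone x w S : kos (cone x w) S + cone x (kos w) S = a x *: w S.
Proof.
rewrite {2}/cone; case: ifP => xS; last first.
  rewrite addr0 /kos (bigD1 x) ?xS //= big1 ?addr0.
    by rewrite /cone setU11 setU1K ?xS // scalerA -mulrA sgn_sqr mulr1.
  by move=> y /andP[yS yx]; rewrite /cone in_setU1 xS eq_sym (negbTE yx) scaler0.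
have -> : S = x |: (S :\ x) by rewrite setD1K.
have: x \notin S :\ x by rewrite !inE eqxx.
move: (S :\ x) => T xT; rewrite setU1K // {2}/kos (bigD1 x) //= scalerDr addrCA.
rewrite scalerA mulrCA sgn_sqr mulr1 -[RHS]addr0; congr (_ + _).
rewrite /kos scaler_sumr.
rewrite [X in _ + X = _](eq_bigl (fun y => y \notin x |: T)); last first.
  by move=> y; rewrite !inE negb_or andbC.
rewrite -big_split big1 //= => y; rewrite in_setU1 negb_or => /andP[yx yT].
rewrite /cone setUCA setU11 setU1K; last by rewrite in_setU1 eq_sym negb_or yx.
rewrite !scalerA -scalerDl.
rewrite (_ : _ + _ = 0) ?scale0r // !sgn_setU1 //.
rewrite (_ : sgn x T * _ = a y * (sgn x T * sgn y T)); last by ring.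
have : rk x != rk y by apply: contra_neq yx => /rk_inj.
rewrite neq_ltn => /orP[lt|lt]; rewrite lt ltnNge (ltnW lt) /=; ring.
Qed.

End Module.
End KoszulComplex.

(** * Acyclicity of a relative independence complex *)

Section IndependenceComplex.

Variables (K : fieldType) (U : finType) (rk : U -> nat).
Hypothesis rk_inj : injective rk.
Variable g : rel U.
Hypothesis g_sym : symmetric g.
Implicit Types (A B W S T : {set U}) (c e w : {set U} -> K^o).

Definition bd c : {set U} -> K^o := kos rk (fun=> 1) c.

Definition indep S := [forall u in S, forall v in S, ~~ g u v].

Definition covers S B := [forall b in B, exists s in S, g s b].

Definition chain_on W c := forall S, c S != 0 -> (S \subset W) && indep S.

(* The sets [S \subset A] covering [B] are those that no vertex of [B] can extend; leaving them
   out makes the complex acyclic. *)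
Definition rel_chain A B c := forall S, c S != 0 ->
  [&& S \subset A :|: B, indep S & ~~ ((S \subset A) && covers S B)].

Lemma indepP S : reflect {in S &, forall u v, ~~ g u v} (indep S).
Proof.
apply: (iffP forall_inP) => [h u v uS vS|h u uS].
  by move/forall_inP: (h u uS); apply.
by apply/forall_inP => v vS; apply: h.
Qed.

Lemma indepS S T : S \subset T -> indep T -> indep S.
Proof. by move=> /subsetP st /indepP h; apply/indepP => u v /st uT /st vT; apply: h. Qed.

Lemma coversP S B : reflect (forall b, b \in B -> exists2 s, s \in S & g s b) (covers S B).
Proof.
apply: (iffP forall_inP) => h b bB; first by apply/exists_inP/h.
by apply/exists_inP/h.
Qed.

Lemma eq_bd c e : c =1 e -> bd c =1 bd e.
Proof. exact: eq_kos. Qed.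

Lemma bdD c e S : bd (fun S' => c S' + e S') S = bd c S + bd e S.
Proof. exact: kosD. Qed.

Lemma bdB c e S : bd (fun S' => c S' - e S') S = bd c S - bd e S.
Proof. exact: kosB. Qed.

Lemma bd_neq0 c S : bd c S != 0 -> exists2 x, x \notin S & c (x |: S) != 0.
Proof.
move=> h; suff /existsP[x /andP[xS cx]] : [exists x, (x \notin S) && (c (x |: S) != 0)].
  by exists x.
apply: contraNT h => /existsPn h; rewrite /bd /kos big1 // => x xS.
by have := h x; rewrite xS negbK => /eqP->; rewrite scaler0.
Qed.

Lemma bd_bd c S : bd (bd c) S = 0.
Proof. exact: kosK. Qed.

Lemma bd_cone x w S : bd (cone rk x w) S = w S - cone rk x (bd w) S.
Proof. by apply/eqP; rewrite eq_sym subr_eq eq_sym; apply/eqP; rewrite kos_cone // scale1r. Qed.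

Lemma cone_neq0 x w S : cone (R := K) rk x w S != 0 -> x \in S /\ w (S :\ x) != 0.
Proof.
rewrite /cone; case: ifP => [xS h|]; last by rewrite eqxx.
by split=> //; apply: contra_neq h => ->; rewrite scaler0.
Qed.

Lemma add_neq0 (x y : K^o) : x + y != 0 -> x != 0 \/ y != 0.
Proof.
by case: (eqVneq x 0) => [->|]; [rewrite add0r; right|left].
Qed.

(** Induction on |A| by link and deletion of a vertex [a] of A. In the link, [a] already covers its
    neighbors, so the sets left out become those covering [B']. For empty A, a vertex of B is a cone
    point; if B is empty too, the only candidate is the empty set, which is left out. *)
Lemma rel_cycle_boundary A B c : [disjoint A & B] -> indep A -> indep B ->
  rel_chain A B c -> bd c =1 (fun=> 0) ->
  exists2 e, rel_chain A B e & c =1 bd e.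
Proof.
move: {2}#|A| (leqnn #|A|) => m; elim: m A B c => [|m IH] A B c.
  rewrite leqn0 cards_eq0 => /eqP-> _ _ indB relc cyc.
  have cB S : c S != 0 -> (S \subset B).
    by move/relc; rewrite set0U => /andP[].
  case: (set_0Vmem B) => [B0|[b bB]].
    exists (fun=> 0) => S; first by rewrite eqxx.
    rewrite /bd /kos big1 => [|x _]; last by rewrite scaler0.
    apply/eqP; apply: contraT => cS; have /and3P[_ _] := relc _ cS.
    rewrite (_ : covers S B) ?andbT; last by apply/coversP => x; rewrite B0 inE.
    by have := cB _ cS; rewrite B0 => ->.
  exists (cone rk b c) => S.
    move=> /cone_neq0[bS /cB sB]; have SB : S \subset B.
      by rewrite -(setD1K bS) subUset sub1set bB.
    rewrite set0U SB (indepS SB indB) /= negb_and; apply/orP; left.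
    by apply/negP => /subsetP/(_ _ bS); rewrite inE.
  rewrite bd_cone /cone; case: ifP; rewrite ?subr0 // cyc scaler0 subr0 //.
case: (set_0Vmem A) => [A0 _|[a aA] leA]; first by apply: IH; rewrite A0 cards0.
move=> dAB indA indB relc cyc.
pose A' := A :\ a; pose B' := [set b in B | ~~ g a b].
have leA' : (#|A'| <= m)%N by move: leA; rewrite (cardsD1 a) aA.
have subA : A' \subset A by apply: subD1set.
have subB : B' \subset B by apply/subsetP => x; rewrite inE => /andP[].
have indA' : indep A' := indepS subA indA.
have indB' : indep B' := indepS subB indB.
have dA'B : [disjoint A' & B] := disjointWl subA dAB.
have dA'B' : [disjoint A' & B'] := disjointWr subB dA'B.
(* Link and deletion: [c] is e_a ∧ [u] plus [v], and neither [u] nor [v] involves [a]. *)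
pose u S : K^o := if a \in S then 0 else sgn rk K a S *: c (a |: S).
pose v S : K^o := if a \in S then 0 else c S.
have cE S : c S = cone rk a u S + v S.
  rewrite /v /cone /u; case: ifP => aS; rewrite ?add0r // addr0.
  by rewrite !inE eqxx /= setD1K // scalerA sgn_sqr scale1r.
have uN S : u S != 0 -> a \notin S /\ c (a |: S) != 0.
  rewrite /u; case: ifP; rewrite ?eqxx // => _ h; split=> //.
  by apply: contra_neq h => ->; rewrite scaler0.
have vN S : v S != 0 -> a \notin S /\ c S != 0.
  by rewrite /v; case: ifP; rewrite ?eqxx.
have cycu : bd u =1 (fun=> 0).
  move=> S; case: (boolP (a \in S)) => aS.
    apply/eqP/contraT => /bd_neq0[x _ /uN[]]; by rewrite in_setU1 aS orbT.
  have := cyc (a |: S); rewrite (eq_bd cE) bdD bd_cone.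
  rewrite /cone setU11 setU1K //.
  rewrite {1}/u setU11 add0r (_ : bd v _ = 0); last first.
    apply/eqP/contraT => /bd_neq0[x _ /vN[]]; by rewrite !inE eqxx orbT.
  rewrite addr0 => /eqP; rewrite oppr_eq0 => /eqP h.
  by have := congr1 ( *:%R (sgn rk K a S)) h; rewrite scalerA sgn_sqr scale1r scaler0.
have relu : rel_chain A' B' u.
  move=> S /uN[aS /relc/and3P[sub ind ncov]]; apply/and3P; split.
  - apply/subsetP => x xS; have xa : x != a by apply: contraNneq aS => <-.
    have := subsetP sub x; rewrite !inE xS orbT xa /= => /(_ isT)/orP[->//|->].
    by rewrite (indepP _ ind) ?orbT // !inE ?eqxx ?xS ?orbT.
  - by apply: indepS ind; apply: subsetUr.
  apply: contra ncov => /andP[sA /coversP cov]; apply/andP; split.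
    by rewrite subUset sub1set aA (subset_trans sA).
  apply/coversP => b bB; case: (boolP (g a b)) => ab; first by exists a; rewrite ?setU11.
  by have [|s sS sb] := cov b; [rewrite inE bB|exists s; rewrite // in_setU1 sS orbT].
have [w relw uw] := IH _ _ _ leA' dA'B' indA' indB' relu cycu.
have relvw : rel_chain A' B (fun S => v S + w S).
  move=> S /add_neq0[/vN[aS]/relc|/relw] /and3P[sub ind ncov]; apply/and3P; split=> //.
  - apply/subsetP => x xS; have xa : x != a by apply: contraNneq aS => <-.
    by have := subsetP sub x xS; rewrite !inE xa.
  - by apply: contra ncov => /andP[/subset_trans->].
  - by apply: (subset_trans sub); apply: setUS.
  apply: contra ncov => /andP[-> /coversP cov]; apply/coversP => b bB'.
  by apply: cov; apply: (subsetP subB).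
(* Filling [u] by [w] in the link makes [c] homologous to [v + w], a cycle that avoids [a]. *)
have vwE S : v S + w S = c S + bd (cone rk a w) S.
  have -> : bd (cone rk a w) S = w S - cone rk a u S.
    by rewrite bd_cone /cone uw.
  by rewrite cE [cone _ _ _ _ + _]addrC addrACA subrr addr0.
have cycvw : bd (fun S => v S + w S) =1 (fun=> 0).
  by move=> S; rewrite (eq_bd vwE) bdD cyc bd_bd addr0.
have [e' rele' e'E] := IH _ _ _ leA' dA'B indA' indB relvw cycvw.
exists (fun S => e' S - cone rk a w S); last first.
  by move=> S; rewrite bdB -e'E vwE addrK.
move=> S /add_neq0[/rele'|].
  case/and3P => sub ind ncov; rewrite ind (subset_trans sub (setSU _ subA)) /=.
  apply: contra ncov => /andP[/subsetP SA ->]; rewrite andbT.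
  apply/subsetP => x xS; have := subsetP sub x xS; rewrite in_setU => /orP[//|xB].
  by have := disjointFr dAB (SA _ xS); rewrite xB.
rewrite oppr_eq0 => /cone_neq0[aS /relw/and3P[sub ind ncov]].
have subS : S \subset A :|: B.
  rewrite -(setD1K aS) subUset sub1set inE aA /=.
  by apply: (subset_trans sub); apply: setUSS.
rewrite subS /=; apply/andP; split.
  have aN x : x \in S -> ~~ g a x.
    move=> xS; case: (eqVneq x a) => [->|xa]; first exact: (indepP _ indA).
    have := subsetP sub x; rewrite !inE xa xS /= => /(_ isT)/orP[xA|/andP[]//].
    exact: (indepP _ indA).
  apply/indepP => x y xS yS; case: (eqVneq x a) => [->|xa]; first exact: aN.
  case: (eqVneq y a) => [->|ya]; first by rewrite g_sym aN.
  by apply: (indepP _ ind); rewrite !inE ?xa ?ya.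
apply: contra ncov => /andP[SA /coversP cov]; apply/andP; split; first exact: setSD.
apply/coversP => b; rewrite inE => /andP[bB ab].
have [s sS sb] := cov b bB; exists s => //; rewrite !inE sS andbT.
by apply: contraNneq ab => <-.
Qed.

End IndependenceComplex.

(** * The bipartite double: vanishing in high degrees, and non-exactness by parity *)

Section BipartiteDouble.

Variables (K : fieldType) (V : finType) (r : rel V).
Variable rk : V + V -> nat.
Hypothesis rk_inj : injective rk.
Local Notation U := (V + V)%type.
Implicit Types (A B P : {set V}) (S : {set U}) (c : {set U} -> K^o).

Definition bip (u v : U) : bool :=
  match u, v with
  | inl x, inr y => r x y
  | inr y, inl x => r x y
  | _, _ => false
  end.

Definition parts A B : {set U} :=
  [set u : U | match u with inl x => x \in A | inr y => y \in B end].

Lemma in_partsl x A B : (inl x \in parts A B) = (x \in A).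
Proof. by rewrite inE. Qed.

Lemma in_partsr y A B : (inr y \in parts A B) = (y \in B).
Proof. by rewrite inE. Qed.

Definition in_parts := (in_partsl, in_partsr).

Lemma bip_sym : symmetric bip.
Proof. by move=> [x|x] [y|y]. Qed.

Lemma subset_parts A B A' B' :
  A \subset A' -> B \subset B' -> parts A B \subset parts A' B'.
Proof.
by move=> /subsetP sA /subsetP sB; apply/subsetP => -[x|x]; rewrite !inE => /[dup]; [move/sA|move/sB].
Qed.

Lemma partsU A B : parts A set0 :|: parts set0 B = parts A B.
Proof. by apply/setP => -[x|x]; rewrite !inE ?orbF. Qed.

Lemma disjoint_parts A B : [disjoint parts A set0 & parts set0 B].
Proof. by rewrite disjoint_subset; apply/subsetP => -[x|x]; rewrite !inE. Qed.

Lemma indep_left A : indep bip (parts A set0).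
Proof. by apply/indepP => -[x|x] [y|y]; rewrite !inE. Qed.

Lemma indep_right B : indep bip (parts set0 B).
Proof. by apply/indepP => -[x|x] [y|y]; rewrite !inE. Qed.

Lemma card_left A : #|parts A set0| = #|A|.
Proof.
rewrite -(card_imset (mem A) (f := inl : V -> U)); last by move=> x y [].
apply: eq_card => -[x|x]; rewrite !inE.
  by apply/idP/imsetP => [xA|[y yA [->]]//]; exists x.
by apply/esym/imsetP => -[].
Qed.

Lemma card_right B : #|parts set0 B| = #|B|.
Proof.
rewrite -(card_imset (mem B) (f := inr : V -> U)); last by move=> x y [].
apply: eq_card => -[x|x]; rewrite !inE.
  by apply/esym/imsetP => -[].
by apply/idP/imsetP => [xA|[y yA [->]]//]; exists x.
Qed.

(* Removing an edge P of M from A or from B leaves |A| + |B| - 2|M| unchanged, and removing it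
   from both decreases it by 2, matching the degree drop of the connecting map. *)
Lemma disjoint_edges_boundary (M : {set {set V}}) A B c :
  trivIset M ->
  (forall P, P \in M -> [/\ #|P| = 2, P \subset A :&: B & {in P &, forall x y, r x y}]) ->
  chain_on bip (parts A B) c -> bd rk c =1 (fun=> 0) ->
  (forall S, c S != 0 -> (#|A| + #|B| < 2 * #|S| + 2 * #|M|)%N) ->
  exists2 e, chain_on bip (parts A B) e & c =1 bd rk e.
Proof.
move: {2}#|M| (erefl #|M|) => m; elim: m M A B c => [|m IH] M A B c.
  move=> /cards0_eq-> _ _ onc cyc big.
  (* Without edges the bound reads |A| + |B| < 2|S|, so no [S] in the support fits inside the
     smaller side. With that side in the first role, no set that is left out occurs in [c]. *)
  have [e rele eE] : exists2 e, rel_chain bip (parts A set0) (parts set0 B) e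
      \/ rel_chain bip (parts set0 B) (parts A set0) e & c =1 bd rk e.
    case: (leqP #|A| #|B|) => AB.
      have [||||e rele eE] := @rel_cycle_boundary K U rk rk_inj bip bip_sym
        (parts A set0) (parts set0 B) c _ _ _ _ cyc; last by exists e; [left|].
      - exact: disjoint_parts.
      - exact: indep_left.
      - exact: indep_right.
      move=> S cS; have /andP[sub ->] := onc S cS; rewrite partsU sub /=.
      apply/negP => /andP[/subset_leq_card]; rewrite card_left.
      have := big S cS; rewrite cards0; lia.
    have [||||e rele eE] := @rel_cycle_boundary K U rk rk_inj bip bip_sym
        (parts set0 B) (parts A set0) c _ _ _ _ cyc; last by exists e; [right|].
    - by rewrite disjoint_sym disjoint_parts.
    - exact: indep_right.
    - exact: indep_left.
    move=> S cS; have /andP[sub ->] := onc S cS; rewrite setUC partsU sub /=.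
    apply/negP => /andP[/subset_leq_card]; rewrite card_right.
    have := big S cS; rewrite cards0; lia.
  exists e => // S eS; case: rele => /(_ S eS)/and3P[+ -> _].
    by rewrite partsU => ->.
  by rewrite setUC partsU => ->.
move=> cardM triv HM onc cyc big.
have [P PM] : exists P, P \in M by apply/set0Pn; rewrite -card_gt0 cardM.
have [P2 PAB Pr] := HM P PM.
have PA : P \subset A by apply: subset_trans PAB (subsetIl _ _).
have PB : P \subset B by apply: subset_trans PAB (subsetIr _ _).
have cardA : #|A| = (#|A :\: P| + 2)%N by rewrite -(cardsID P A) (setIidPr PA) P2 addnC.
have cardB : #|B| = (#|B :\: P| + 2)%N by rewrite -(cardsID P B) (setIidPr PB) P2 addnC.
have cardM' : #|M :\ P| = m by move: cardM; rewrite (cardsD1 P) PM => -[].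
have triv' : trivIset (M :\ P).
  by move/trivIsetP: triv => triv; apply/trivIsetP => X Y /setD1P[_ XM] /setD1P[_ YM]; apply: triv.
have HM' A' B' : A :\: P \subset A' -> B :\: P \subset B' -> forall Q, Q \in M :\ P ->
    [/\ #|Q| = 2, Q \subset A' :&: B' & {in Q &, forall x y, r x y}].
  move=> sA sB Q /setD1P[QP QM]; have [Q2 QAB Qr] := HM Q QM; split=> //.
  have dQP : [disjoint Q & P] by move/trivIsetP: triv; apply.
  move: QAB; rewrite !subsetI => /andP[QA QB]; apply/andP; split.
    by apply: subset_trans sA; rewrite subsetD QA.
  by apply: subset_trans sB; rewrite subsetD QB.
(* [cp] avoids the right copy of [P]. A set in [cm] meets that copy, hence avoids the left copy,
   because the two copies of [P] are completely joined. *)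
pose cp S : K^o := if [disjoint S & parts set0 P] then c S else 0.
pose cm S : K^o := if [disjoint S & parts set0 P] then 0 else c S.
have cE S : c S = cp S + cm S by rewrite /cp /cm; case: ifP; rewrite ?addr0 ?add0r.
have cpN S : cp S != 0 -> [disjoint S & parts set0 P] /\ c S != 0.
  by rewrite /cp; case: ifP; rewrite ?eqxx.
have cmN S : cm S != 0 -> [disjoint S & parts P set0] /\ c S != 0.
  rewrite /cm; case: ifP; rewrite ?eqxx // => /negbT/pred0Pn[u /= /andP[uS uP]] h; split=> //.
  have /andP[_ /indepP ind] := onc _ h.
  apply/pred0P => v; apply/negP => /= /andP[vS vP].
  case: u uS uP => [x|y] uS; rewrite in_parts ?inE // => yP.
  case: v vS vP => [x|x] vS; rewrite in_parts ?inE // => xP.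
  by have := ind _ _ vS uS; rewrite /= Pr.
have bdE S : bd rk cp S = - bd rk cm S.
  by apply/eqP; rewrite -addr_eq0 -bdD -(eq_bd rk cE) cyc.
have sub_parts S A' B' : S \subset parts A B ->
    (A' = A \/ A' = A :\: P /\ [disjoint S & parts P set0]) ->
    (B' = B \/ B' = B :\: P /\ [disjoint S & parts set0 P]) -> S \subset parts A' B'.
  move=> /subsetP sub HA HB; apply/subsetP => u uS; have := sub u uS.
  case: u uS => [x|x] uS; rewrite !in_parts.
    case: HA => [->//|[-> d]]; have := disjointFr d uS.
    by rewrite in_parts inE => ->.
  case: HB => [->//|[-> d]]; have := disjointFr d uS.
  by rewrite in_parts inE => ->.
(* The connecting cycle: [bd rk cp] equals minus [bd rk cm], so its support avoids both copies of
   [P]. *)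
have [|||y ony yE] := IH (M :\ P) (A :\: P) (B :\: P) (bd rk cp) cardM' triv' (HM' _ _ (subxx _) (subxx _)).
- move=> S h; have [x xS /cpN[d1 /onc/andP[s1 i1]]] := bd_neq0 h.
  have : bd rk cm S != 0 by rewrite -oppr_eq0 -bdE.
  case/bd_neq0 => x' x'S /cmN[d2 _].
  rewrite (indepS (subsetUr _ _) i1) andbT; apply: sub_parts.
  - by apply: subset_trans s1; apply: subsetUr.
  - by right; split=> //; apply: disjointWl d2; apply: subsetUr.
  - by right; split=> //; apply: disjointWl d1; apply: subsetUr.
- by move=> S; rewrite bd_bd.
- move=> S h; have [x xS /cpN[_ /big]] := bd_neq0 h.
  by rewrite cardsU1 xS cardM' cardM cardA cardB; lia.
(* The induction hypothesis gives no size bound on [y]. Dropping its small sets restores the bound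
   and keeps the boundary, since the boundary respects cardinality. *)
pose y' S : K^o := if (#|A| + #|B| < 2 * #|S| + 2 * #|M|)%N then y S else 0.
have y'N S : y' S != 0 -> (#|A| + #|B| < 2 * #|S| + 2 * #|M|)%N /\ y S != 0.
  by rewrite /y'; case: ifP; rewrite ?eqxx.
have y'E S : bd rk y' S = bd rk cp S.
  rewrite yE; case: (boolP (#|A| + #|B| < 2 * (#|S|.+1) + 2 * #|M|)%N) => big'.
    by apply: eq_bigr => x xS; rewrite /y' cardsU1 xS add1n big'.
  rewrite (_ : bd rk y' S = 0); last first.
    apply/eqP/contraT => /bd_neq0[x xS /y'N[]]; by rewrite cardsU1 xS add1n (negbTE big').
  apply/esym/eqP; rewrite -yE; apply/contraT => /bd_neq0[x xS /cpN[_ /big]].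
  by rewrite cardsU1 xS add1n (negbTE big').
(* Correcting by [y'] turns both pieces into cycles, [cp - y'] and [cm + y'], each on a part with
   [P] removed from one side only. *)
have [|||e1 one1 e1E] := IH (M :\ P) A (B :\: P) (fun S => cp S - y' S) cardM' triv'
   (HM' _ _ (subsetDl _ _) (subxx _)).
- move=> S /add_neq0[/cpN[d /onc/andP[s ->]]|]; rewrite ?andbT.
    by apply: sub_parts => //; [left|right].
  rewrite oppr_eq0 => /y'N[_ /ony/andP[s ->]]; rewrite andbT.
  by apply: subset_trans s _; apply: subset_parts; rewrite ?subsetDl.
- by move=> S; rewrite bdB y'E subrr.
- move=> S h; have : (#|A| + #|B| < 2 * #|S| + 2 * #|M|)%N.
    by move: h => /add_neq0[/cpN[_ /big]//|]; rewrite oppr_eq0 => /y'N[].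
  by rewrite cardM' cardM cardB; lia.
have [|||e2 one2 e2E] := IH (M :\ P) (A :\: P) B (fun S => cm S + y' S) cardM' triv'
   (HM' _ _ (subxx _) (subsetDl _ _)).
- move=> S /add_neq0[/cmN[d /onc/andP[s ->]]|]; rewrite ?andbT.
    by apply: sub_parts => //; [right|left].
  move=> /y'N[_ /ony/andP[s ->]]; rewrite andbT.
  by apply: subset_trans s _; apply: subset_parts; rewrite ?subsetDl.
- by move=> S; rewrite bdD y'E bdE addrN.
- move=> S h; have : (#|A| + #|B| < 2 * #|S| + 2 * #|M|)%N.
    by move: h => /add_neq0[/cmN[_ /big]//|/y'N[]].
  by rewrite cardM' cardM cardA; lia.
exists (fun S => e1 S + e2 S) => S.
  move=> /add_neq0[/one1|/one2] /andP[s ->]; rewrite andbT;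
    by apply: subset_trans s _; apply: subset_parts; rewrite ?subsetDl.
by rewrite bdD -e1E -e2E cE addrACA addNr addr0.
Qed.

Lemma odd_card_involution (T : finType) (f : T -> T) (E : {set T}) :
  involutive f -> {homo f : x / x \in E} -> odd #|E| = odd #|[set x in E | f x == x]|.
Proof.
move=> fK fE; pose rank (x : T) : nat := enum_rank x.
have fEE x : (f x \in E) = (x \in E) by apply/idP/idP => /fE; rewrite ?fK.
(* The moved points split into those ranked below and those ranked above their image; [f] exchanges
   the two halves. *)
pose L := [set x in E | rank x < rank (f x)]%N.
pose G := [set x in E | rank (f x) < rank x]%N.
have GL : #|G| = #|L|.
  rewrite -(card_imset (mem L) (inv_inj fK)); apply: eq_card => x.
  by rewrite -{2}[x]fK (mem_imset _ _ (inv_inj fK)) !inE fEE fK.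
rewrite -(cardsID [set x | f x == x] E) oddD.
rewrite (_ : E :\: _ = L :|: G); last first.
  apply/setP => x; rewrite !inE -andb_orr andbC -neq_ltn; congr (_ && _).
  by congr (~~ _); apply/eqP/eqP => [->//|/val_inj/enum_rank_inj].
rewrite cardsU (_ : L :&: G = set0) ?cards0 ?subn0.
  by rewrite GL addnn odd_double addbF; congr (odd _); apply: eq_card => x; rewrite !inE.
apply/setP => x; rewrite !inE; apply/negP => /andP[/andP[_ h1] /andP[_ h2]].
by have := ltn_trans h1 h2; rewrite ltnn.
Qed.

Hypotheses (r_refl : reflexive r) (r_sym : symmetric r).

Lemma odd_indep : odd #|[set S | indep bip S]|.
Proof.
pose f (u : U) : U := match u with inl x => inr x | inr x => inl x end.
have fK : involutive f by case.
rewrite (@odd_card_involution _ (fun S => f @: S)).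
- rewrite (_ : [set S in _ | _] = [set set0]) ?cards1 //.
  apply/setP => S; rewrite !inE; apply/andP/eqP => [[/indepP ind /eqP fS]|->]; last first.
    by rewrite imset0; split=> //; apply/indepP => u v; rewrite inE.
  apply/setP => u; rewrite inE; apply/negP => uS.
  (* A swap-invariant set containing [u] contains the other copy of the same vertex, which is
     adjacent to [u] by reflexivity of [r]. *)
  have fuS : f u \in S by rewrite -fS imset_f.
  by move: (ind _ _ uS fuS); case: (u) => x; rewrite /= r_refl.
- by move=> S; rewrite -imset_comp (eq_imset _ (g := id)) ?imset_id.
move=> S; rewrite !inE => /indepP ind; apply/indepP => _ _ /imsetP[u uS ->] /imsetP[v vS ->].
by move: (ind _ _ uS vS); case: (u) (v) => [x|x] [y|y] //=; rewrite r_sym.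
Qed.

(* A differential D with kernel = image has N = 2 rank D. *)
Lemma indep_complex_not_exact :
  ~ (forall c, chain_on bip setT c -> bd rk c =1 (fun=> 0) ->
       exists2 e, chain_on bip setT e & c =1 bd rk e).
Proof.
move=> exact; pose E := [set S | indep bip S]; pose N := #|E|.
pose s (i : 'I_N) : {set U} := enum_val i.
have sE i : indep bip (s i) by have := enum_valP i; rewrite inE.
(* [ch] and [rw] identify row vectors with chains of independent sets; [D] is the matrix of [bd]
   under this identification. *)
pose ch (v : 'rV[K]_N) S : K^o := \sum_i v 0 i * (s i == S)%:R.
pose rw c : 'rV[K]_N := \row_i c (s i).
pose D : 'M[K]_N := \matrix_(i, j)
  \sum_(x | x \notin s j) sgn rk K x (s j) * (s i == x |: s j)%:R.
have ch_chain v : chain_on bip setT (ch v).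
  move=> S; rewrite subsetT; apply: contraR => ind; rewrite /ch big1 // => i _.
  by case: eqP => [e|]; rewrite ?mulr0 //; rewrite -e sE in ind.
have rowK c : chain_on bip setT c -> ch (rw c) =1 c.
  move=> onc S; case: (boolP (indep bip S)) => [ind|].
    have SE : S \in E by rewrite inE.
    have sS : s (enum_rank_in SE S) = S by rewrite /s enum_rankK_in.
    rewrite /ch (bigD1 (enum_rank_in SE S)) //= mxE sS eqxx mulr1 big1 ?addr0 // => i ij.
    case: eqP => [e|]; rewrite ?mulr0 //.
    by case/eqP: ij; apply: enum_val_inj; rewrite -/(s i) e -[LHS]sS.
  move=> nind; transitivity (0 : K^o).
    by apply/eqP; apply: contraNT nind => /ch_chain/andP[].
  by apply/esym/eqP; apply: contraNT nind => /onc/andP[].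
have chK v : rw (ch v) = v.
  apply/rowP => j; rewrite mxE /ch (bigD1 j) //= eqxx mulr1 big1 ?addr0 // => i ij.
  by case: eqP => [/enum_val_inj e|]; rewrite ?mulr0 //; rewrite e eqxx in ij.
have bd_chain c : chain_on bip setT c -> chain_on bip setT (bd rk c).
  move=> onc S /bd_neq0[x _ /onc/andP[_ ind]].
  by rewrite subsetT (indepS (subsetUr _ _) ind).
have mulD v : v *m D = rw (bd rk (ch v)).
  apply/rowP => j; rewrite !mxE /bd /kos.
  under eq_bigr do rewrite mxE mulr_sumr.
  rewrite exchange_big; apply: eq_bigr => x _; rewrite mul1r scaler_sumr.
  by apply: eq_bigr => i _; rewrite mulrCA.
have rw0 c : c =1 (fun=> 0) -> rw c = 0.
  by move=> c0; apply/rowP => j; rewrite !mxE c0.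
have DD : D *m D = 0.
  apply/row_matrixP => i; rewrite row0 rowE mulmxA !mulD; apply: rw0 => S.
  by rewrite (eq_bd _ (rowK _ (bd_chain _ (ch_chain _)))) bd_bd.
have kerD : (kermx D <= D)%MS.
  apply/row_subP => i; set v := row i _.
  have vD : v *m D = 0 by rewrite /v -row_mul mulmx_ker row0.
  have cyc : bd rk (ch v) =1 (fun=> 0).
    move=> S; rewrite -(rowK _ (bd_chain _ (ch_chain v))) -mulD vD /ch big1 // => j _.
    by rewrite mxE mul0r.
  have [e one vE] := exact _ (ch_chain v) cyc.
  apply/submxP; exists (rw e); rewrite mulD -[v]chK; apply/rowP => j.
  by rewrite !mxE vE (eq_bd _ (rowK _ one)).
have := odd_indep; rewrite -/E -/N.
have /eqP : \rank (kermx D) = \rank D.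
  by apply/eqP; rewrite eqn_leq !mxrankS // sub_kermx DD.
rewrite mxrank_ker => /eqP rD.
rewrite (_ : N = (\rank D).*2) ?odd_double // -addnn -{1}rD subnK //.
exact: rank_leq_row.
Qed.

End BipartiteDouble.

(** * Exactness of the Koszul complex of the variables *)

Section PolynomialKoszul.

Variables (K : fieldType) (n : nat).
Local Notation R := {mpoly K[n]}.
Implicit Types (x y : 'I_n) (p q : R) (m : 'X_{1..n}).

Lemma mcoeffXM x p m :
  ('X_x * p)@_m = if m x == 0%N then 0 else p@_(m - U_(x)).
Proof.
case: eqP => [mx|/eqP mx]; last first.
  have -> : 'X_x * p = p * 'X_[U_(x)] by rewrite mulrC.
  rewrite -[in LHS](@submK _ U_(x) m); first by rewrite addmC mcoeffMX.
  by apply/mnm_lepP => i; rewrite mnm1E; case: eqP => // <-; rewrite lt0n.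
rewrite [p]mpolyE mulr_sumr raddf_sum big1 //= => k _.
rewrite -scalerAr -mpolyXD mcoeffZ mcoeffX; case: eqP => [e|]; rewrite ?mulr0 //.
by move: mx; rewrite -e mnmDE mnm1E eqxx.
Qed.

(** Division by ['X_x] that discards the terms free of [x]: a linear left inverse of multiplication
    by ['X_x] that commutes with the other variables. *)
Definition quoX x p : R :=
  \sum_(m <- msupp p | m x != 0%N) p@_m *: 'X_[m - U_(x)].

Lemma mcoeff_quoX x p m : (quoX x p)@_m = p@_(m + U_(x)).
Proof.
rewrite raddf_sum /=.
under eq_bigr do rewrite mcoeffZ mcoeffX.
have mU (k : 'X_{1..n}) : k x != 0%N -> ((k - U_(x))%MM == m) = (k == (m + U_(x))%MM).
  move=> kx; apply/eqP/eqP => [<-|->]; last by rewrite addmK.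
  by rewrite submK //; apply/mnm_lepP => i; rewrite mnm1E; case: eqP => // <-; rewrite lt0n.
under eq_bigr => k kx do rewrite mU //.
case: (boolP ((m + U_(x))%MM \in msupp p)) => mp; last first.
  rewrite (memN_msupp_eq0 mp) big_seq_cond big1 // => k /andP[kp _].
  by case: eqP => [e|]; rewrite ?mulr0 //; rewrite -e kp in mp.
rewrite big_mkcond (bigD1_seq _ mp (msupp_uniq p)) /= mnmDE mnm1E !eqxx addn1 /= mulr1.
by rewrite big1 ?addr0 // => k /negbTE->; rewrite mulr0 if_same.
Qed.

Lemma quoX_is_linear x : linear (quoX x).
Proof.
move=> a p q; apply/mpolyP => m.
by rewrite mcoeffD mcoeffZ !mcoeff_quoX mcoeffD mcoeffZ.
Qed.

HB.instance Definition _ x := GRing.isLinear.Build K R R _ (quoX x) (quoX_is_linear x).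

Lemma quoX_XM x p : quoX x ('X_x * p) = p.
Proof.
apply/mpolyP => m; rewrite mcoeff_quoX mcoeffXM mnmDE mnm1E eqxx addn1 /=.
by rewrite addmK.
Qed.

Lemma quoX_XM_neq x y p : x != y -> quoX x ('X_y * p) = 'X_y * quoX x p.
Proof.
move=> xy; apply/mpolyP => m; rewrite mcoeff_quoX !mcoeffXM mcoeff_quoX mnmDE mnm1E.
rewrite (negbTE xy) addn0; case: eqP => // /eqP my; congr (_@__).
apply/mnmP => i; rewrite !(mnmDE, mnmBE, mnm1E); case: (eqVneq x i) => [<-|_].
  by rewrite eq_sym (negbTE xy) !subn0.
by rewrite !addn0.
Qed.

Implicit Types (S T : {set 'I_n}).

Definition kosX (M : lmodType R) (c : {set 'I_n} -> M) S : M :=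
  kos (@nat_of_ord n) (fun x => 'X_x : R) c S.

Definition coneX x (w : {set 'I_n} -> R^o) S : R^o := cone (@nat_of_ord n) x w S.

(** Subtracting this boundary from [c] leaves only exterior terms without [x] whose coefficients are
    free of the variable [x]. *)
Lemma kosX_contract x (c : {set 'I_n} -> R^o) S : kosX c =1 (fun=> 0) ->
  kosX (coneX x (fun T => quoX x (c T) : R^o)) S =
  if x \in S then c S else 'X_x * quoX x (c S).
Proof.
move=> cyc; set w := fun T => quoX x (c T) : R^o.
have -> : kosX (coneX x w) S = 'X_x *: w S - coneX x (kosX w) S.
  by apply/eqP; rewrite eq_sym subr_eq eq_sym; apply/eqP; apply/kos_cone/val_inj.
rewrite /coneX /cone; case: ifP => xS; last by rewrite subr0.
set T := S :\ x; have xT : x \notin T by rewrite !inE eqxx.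
have -> : S = x |: T by rewrite setD1K.
rewrite {1}/kosX /kos (bigD1 x) //= scalerDr scalerA mulrCA sgn_sqr mulr1 opprD addrA subrr sub0r.
(* The cycle equation at [T], divided by ['X_x], expresses [c (x |: T)] through the remaining
   summands. *)
have := congr1 (quoX x) (cyc T); rewrite raddf0 /kosX /kos raddf_sum (bigD1 x) //=.
rewrite /GRing.scale /= -mulrA quoX_XM /sgn raddfMsign.
rewrite [X in _ + X = _](_ : _ = \sum_(i | (i \notin T) && (i != x))
    'X_i * (-1) ^+ #|[set y in T | (y < i)%N]| * w (i |: T)); last first.
  apply: eq_bigr => i /andP[_ ix]; rewrite -!mulrA quoX_XM_neq 1?eq_sym //.
  by rewrite raddfMsign.
set B := \sum_(i | _) _; move/eqP; rewrite addr_eq0 => /eqP h.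
suff -> : c (x |: T) = (-1) ^+ #|[set y in T | (y < x)%N]| * - B by reflexivity.
by rewrite -h mulrA -expr2 sqrr_sign mul1r.
Qed.

(* Homotopies contract one variable at a time; what survives all of them is the
   constant term in exterior degree 0. *)
Lemma kosX_exact (c : {set 'I_n} -> R^o) :
  kosX c =1 (fun=> 0) -> (c set0)@_0%MM = 0 -> exists e : {set 'I_n} -> R^o, c =1 kosX e.
Proof.
move=> cyc c0.
(* Invariant over the variables treated so far: [c'] is homologous to [c], has no new monomials, and
   involves none of these variables in either the exterior or the polynomial factor. *)
suff [c' [e [cE _ supp]]] : exists c' : {set 'I_n} -> R^o, exists e : {set 'I_n} -> R^o,
   [/\ forall S, c S = c' S + kosX e S, kosX c' =1 (fun=> 0) &
       forall S m, (c' S)@_m != 0 ->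
         (c S)@_m != 0 /\ {in enum 'I_n, forall x, x \notin S /\ m x = 0%N}].
  exists e => S; rewrite cE (_ : c' S = 0) ?add0r //; apply/mpolyP => m.
  rewrite mcoeff0; apply/eqP; apply: contraT => /[dup] ne /supp[cne h].
  have hx x : x \notin S /\ m x = 0%N by apply: h; rewrite mem_enum.
  have S0 : S = set0 by apply/setP => x; rewrite inE (negbTE (hx x).1).
  have m0 : m = 0%MM by apply/mnmP => x; rewrite mnm0E (hx x).2.
  by rewrite S0 m0 c0 eqxx in cne.
elim: (enum 'I_n) => [|x s [c' [e [cE cyc' supp]]]].
  exists c, (fun=> 0); split=> // S; rewrite /kosX /kos big1 ?addr0 // => x _.
  by rewrite scaler0.
pose h := coneX x (fun T => quoX x (c' T) : R^o).
exists (fun S => c' S - kosX h S), (fun S => h S + e S); split.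
- by move=> S; rewrite /kosX kosD addrA subrK cE.
- by move=> S; rewrite /kosX kosB kosK ?subr0; [exact: cyc'|exact: val_inj].
move=> S m; rewrite kosX_contract //; case: ifP => xS; first by rewrite subrr mcoeff0 eqxx.
rewrite mcoeffB mcoeffXM mcoeff_quoX; case: (eqVneq (m x) 0%N) => mx; last first.
  by rewrite submK ?subrr ?eqxx //; apply/mnm_lepP => i; rewrite mnm1E; case: eqP => // <-; rewrite lt0n.
rewrite subr0 => /supp[cne hs]; split=> // y; rewrite inE => /orP[/eqP->|]; last exact: hs.
by rewrite xS.
Qed.

Lemma kosX_row r (c : {set 'I_n} -> 'rV[R]_r) S k :
  kosX c S 0 k = kosX (fun T => c T 0 k : R^o) S.
Proof. by rewrite /kosX /kos summxE; apply: eq_bigr => x _; rewrite !mxE. Qed.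

Lemma kosX_row_exact r (c : {set 'I_n} -> 'rV[R]_r) :
  kosX c =1 (fun=> 0) -> (forall k, (c set0 0 k)@_0%MM = 0) ->
  exists e, c =1 kosX e.
Proof.
move=> cyc c0.
have /fin_all_exists[e eE] k : exists e : {set 'I_n} -> R^o, (fun S => c S 0 k : R^o) =1 kosX e.
  by apply: kosX_exact => // S; rewrite -kosX_row cyc mxE.
exists (fun S => \row_k e k S) => S; apply/rowP => k; rewrite kosX_row eE.
by rewrite /kosX /kos; apply: eq_bigr => x _; rewrite mxE.
Qed.

Lemma kosX_mulmx r s (c : {set 'I_n} -> 'rV[R]_r) (A : 'M[R]_(r, s)) S :
  kosX (fun T => c T *m A) S = kosX c S *m A.
Proof.
by rewrite /kosX /kos mulmx_suml; apply: eq_bigr => x _; rewrite scalemxAl.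
Qed.

End PolynomialKoszul.

(** * Homogeneous components in integer degrees *)

Section Homogeneous.

Variables (K : fieldType) (n : nat).
Local Notation R := {mpoly K[n]}.
Implicit Types (p q : R) (m : 'X_{1..n}) (d : int).

Lemma homog_of_degP d p :
  reflect (forall m, p@_m != 0 -> (mdeg m)%:Z = d) (homog_of_deg d p).
Proof.
apply: (iffP idP); case: d => d /=.
- by move=> /dhomogP h m; rewrite -mcoeff_msupp => /h ->.
- by move=> /eqP-> m; rewrite mcoeff0 eqxx.
- by move=> h; apply/dhomogP => m; rewrite mcoeff_msupp => /h [].
by move=> h; apply/eqP/mpolyP => m; rewrite mcoeff0; apply/eqP/contraT => /h.
Qed.

Definition hproj d p : R := \sum_(m <- msupp p | (mdeg m)%:Z == d) p@_m *: 'X_[m].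

Lemma mcoeff_hproj d p m : (hproj d p)@_m = if (mdeg m)%:Z == d then p@_m else 0.
Proof.
rewrite raddf_sum /=; under eq_bigr do rewrite mcoeffZ mcoeffX.
case: (boolP (m \in msupp p)) => mp; last first.
  rewrite (memN_msupp_eq0 mp) if_same big_seq_cond big1 // => k /andP[kp _].
  by case: eqP => [e|]; rewrite ?mulr0 //; rewrite -e kp in mp.
rewrite big_mkcond (bigD1_seq _ mp (msupp_uniq p)) /= eqxx mulr1.
by rewrite big1 ?addr0 // => k /negbTE->; rewrite mulr0 if_same.
Qed.

Lemma hproj_is_linear d : linear (hproj d).
Proof.
move=> a p q; apply/mpolyP => m; rewrite mcoeffD mcoeffZ !mcoeff_hproj.
by case: ifP; rewrite ?mcoeffD ?mcoeffZ // mulr0 addr0.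
Qed.

HB.instance Definition _ d := GRing.isLinear.Build K R R _ (hproj d) (hproj_is_linear d).

Lemma hproj_homog d p : homog_of_deg d (hproj d p).
Proof. by apply/homog_of_degP => m; rewrite mcoeff_hproj; case: ifP => [/eqP->|_] //; rewrite eqxx. Qed.

Lemma hproj_id d d' p : homog_of_deg d' p -> hproj d p = if d' == d then p else 0.
Proof.
move=> /homog_of_degP h; apply/mpolyP => m; rewrite mcoeff_hproj.
case: (eqVneq (p@_m) 0) => [p0|/h->]; last by case: ifP => //; rewrite mcoeff0.
by rewrite p0 if_same; case: ifP; rewrite ?p0 ?mcoeff0.
Qed.

Lemma homog_of_degM d e p q :
  homog_of_deg d p -> homog_of_deg e q -> homog_of_deg (d + e) (p * q).
Proof.
move=> /homog_of_degP hp /homog_of_degP hq; apply/homog_of_degP => m.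
rewrite -mcoeff_msupp => /msuppM_le/allpairsP[[m1 m2] /= [m1p m2q ->]].
by rewrite mdegD PoszD hp ?hq -?mcoeff_msupp.
Qed.

Lemma homog_of_deg_sum (I : finType) (P : pred I) (f : I -> R) d :
  (forall i, P i -> homog_of_deg d (f i)) -> homog_of_deg d (\sum_(i | P i) f i).
Proof.
move=> h; apply/homog_of_degP => m; rewrite raddf_sum /= => ne.
apply/eqP; move: ne; apply: contraNT => md; rewrite big1 // => i /h/homog_of_degP hi.
by apply/eqP; apply: contraNT md => /hi ->.
Qed.

Lemma homog_of_degX m : homog_of_deg (mdeg m) ('X_[m] : R).
Proof. by apply/homog_of_degP => k; rewrite mcoeffX; case: (eqVneq m k) => [->|] //; rewrite eqxx. Qed.

Lemma homog_of_deg_sign k d p : homog_of_deg d p -> homog_of_deg d ((-1) ^+ k * p).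
Proof.
by rewrite -signr_odd; case: odd; rewrite ?mul1r // mulN1r => /homog_of_degP h;
  apply/homog_of_degP => m; rewrite mcoeffN oppr_eq0 => /h.
Qed.

(** This lets arbitrary lifts along homogeneous matrices be replaced by homogeneous ones. *)
Lemma hprojM d f p q : homog_of_deg f q -> hproj (d + f) (p * q) = hproj d p * q.
Proof.
move=> hq; rewrite [p in LHS]mpolyE mulr_suml linear_sum /hproj mulr_suml /=.
rewrite [RHS]big_mkcond; apply: eq_bigr => m _.
rewrite -scalerAl linearZ /= -/(hproj _ _) (hproj_id _ (homog_of_degM (homog_of_degX m) hq)).
by rewrite (inj_eq (addIr f)); case: eqP => _; rewrite ?scaler0 // scalerAl.
Qed.

End Homogeneous.

(** * The double complex of a resolution with the Koszul complex, in internal degree D *)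

Section Staircase.

Variables (K : fieldType) (n : nat).
Local Notation R := {mpoly K[n]}.
Variables (I : R -> Prop) (F : free_complex K n).
Hypothesis resF : graded_min_free_resolution I F.
Hypothesis I_add : forall p q, I p -> I q -> I (p + q).
Hypothesis I_mul : forall a p, I p -> I (a * p).
Hypothesis I_hproj : forall d p, I p -> I (hproj d p).
Variables (D : int) (L : nat).
Hypothesis no_betti : forall q, (q <= L)%N -> betti F q D = 0%N.
Implicit Types (S T : {set 'I_n}).

Local Notation deg q := (@fr_deg K n F q).

Lemma I_0 : I 0.
Proof. by have [u /(I_mul 0)] := gmfr_surj resF 0; rewrite mul0r. Qed.

Lemma I_sum (J : finType) (P : pred J) (f : J -> R) :
  (forall j, P j -> I (f j)) -> I (\sum_(j | P j) f j).
Proof. by move=> h; apply: (big_ind I) => //; apply: I_0. Qed.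

(** Column [q] of the double complex: internal degree [D], with e_S counted in degree |S|, and
    support in total homological degree at most [L]. *)
Definition staged q (z : {set 'I_n} -> 'rV[R]_(fr_rank F q)) :=
  forall S, (forall k, homog_of_deg (D - #|S|%:Z - deg q k) (z S 0 k)) /\
            (z S != 0 -> (q + #|S| <= L)%N).

Lemma fr_deg_neq q k : (q <= L)%N -> deg q k != D.
Proof.
move=> qL; apply/negP => kD; have := no_betti qL.
by move=> /cards0_eq/setP/(_ k); rewrite !inE kD.
Qed.

Lemma staged_kos q z S k : staged z ->
  homog_of_deg (D - #|S|%:Z - deg q k) (kosX z S 0 k).
Proof.
move=> hz; rewrite kosX_row /kosX /kos; apply: homog_of_deg_sum => x xS.
rewrite /GRing.scale /= -mulrA.
have -> : D - #|S|%:Z - deg q k = (mdeg U_(x)%MM)%:Z + (D - #|x |: S|%:Z - deg q k).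
  by rewrite mdeg1 cardsU1 xS add1n intS; ring.
apply: homog_of_degM; first exact: homog_of_degX.
by apply: homog_of_deg_sign; have [] := hz (x |: S).
Qed.

(* One column of the double complex F (x) Koszul: lift, recurse on the next column, and correct
   using Koszul exactness; the absence of generators of degree D makes the constant term vanish. *)
Lemma staged_split q (z : {set 'I_n} -> 'rV[R]_(fr_rank F q)) : staged z ->
  (forall S, exists v, kosX z S = v *m fr_diff F q) ->
  exists y y', forall S, z S = kosX y S + y' S *m fr_diff F q.
Proof.
have [m] := ubnP (L.+1 - q); elim: m q z => // m IH q z ltm hz lift.
have [qL|qL] := ltnP L q.
  exists (fun=> 0), (fun=> 0) => S; rewrite mul0mx addr0 /kosX /kos big1 => [|x _]; last first.
    by rewrite scaler0.
  by apply/eqP; apply: contraT => /(hz S).2; lia.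
have /fin_all_exists[v vE] := lift.
(* The lift is made homogeneous and cut off beyond total degree [L]. The cut loses nothing:
   [kosX z S] only involves [z] on sets with one more element, which vanishes there. *)
pose z' S : 'rV[R]_(fr_rank F q.+1) := if (q.+1 + #|S| <= L)%N then
  \row_l hproj (D - #|S|%:Z - deg q.+1 l) (v S 0 l) else 0.
have z'E S : z' S *m fr_diff F q = kosX z S.
  rewrite /z'; case: ifP => SL; last first.
    rewrite mul0mx /kosX /kos big1 // => x xS; rewrite (_ : z _ = 0) ?scaler0 //.
    apply/eqP; apply: contraT => /(hz _).2; rewrite cardsU1 xS; lia.
  apply/rowP => k; rewrite !mxE.
  transitivity (hproj (D - #|S|%:Z - deg q k) (kosX z S 0 k)).
    rewrite vE mxE linear_sum; apply: eq_bigr => l _; rewrite mxE.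
    rewrite -(hprojM _ _ (gmfr_diff_homog resF l k)) /=; congr (hproj _ _); lia.
  by rewrite (hproj_id _ (staged_kos S k hz)) eqxx.
have hz' : staged z'.
  move=> S; rewrite /z'; case: ifP => SL; last first.
    by split=> [k|]; rewrite ?eqxx // mxE; apply/homog_of_degP => m'; rewrite mcoeff0 eqxx.
  by split=> // k; rewrite mxE hproj_homog.
have lift' S : exists v, kosX z' S = v *m fr_diff F q.+1.
  apply/(gmfr_exact resF); rewrite -kosX_mulmx.
  transitivity (kosX (kosX z) S); first by apply: eq_bigr => x _; rewrite z'E.
  by apply: kosK; apply: val_inj.
have [|y1 [y1' y1E]] := IH q.+1 z' _ hz' lift'; first by lia.
(* [t] is a Koszul cycle: the recursive splitting changes [kosX z] only by a composite of two
   consecutive differentials. *)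
pose t S := z S - y1 S *m fr_diff F q.
have [||y yE] := @kosX_row_exact K n _ t.
- move=> S; rewrite /t /kosX kosB -/(kosX _ _) -/(kosX _ _) kosX_mulmx -z'E y1E mulmxDl.
  rewrite addrC addKr; apply/(gmfr_exact resF); by exists (y1' S).
(* Minimality removes the constant term of the correction, and [z set0 0 k] is homogeneous of degree
   [D - deg q k], which is nonzero. *)
- move=> k; rewrite /t !mxE mcoeffB raddf_sum /= big1 => [|l _]; last first.
    by rewrite rmorphM /= (gmfr_minimal resF) mulr0.
  rewrite subr0; apply/eqP; apply: contraNT (fr_deg_neq k qL).
  have /homog_of_degP h := (hz set0).1 k => /h; rewrite mdeg0 cards0; lia.
exists y, y1 => S; rewrite -yE subrK //.
Qed.

(** Koszul form of the vanishing of Tor_i(R/I, K) in degree [D] for i <= L. The cycle is lifted to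
    F_0 and split there; the part coming from [fr_diff F 0] maps into [I], leaving a Koszul
    boundary. *)
Lemma kos_cycle_boundary (z : {set 'I_n} -> R^o) :
  (forall S, homog_of_deg (D - #|S|%:Z) (z S)) -> (forall S, z S != 0 -> (#|S| <= L)%N) ->
  (forall S, I (kosX z S)) ->
  exists y : {set 'I_n} -> R^o, forall S, I (z S - kosX y S).
Proof.
move=> homz sz cyc.
have /fin_all_exists[u uI] S : exists u : 'rV[R]_(fr_rank F 0), I (z S - (u *m fr_aug F) 0 0).
  exact: gmfr_surj resF _.
pose z0 S : 'rV[R]_(fr_rank F 0) := if (#|S| <= L)%N then
  \row_l hproj (D - #|S|%:Z - deg 0 l) (u S 0 l) else 0.
have z0I S : I (z S - (z0 S *m fr_aug F) 0 0).
  rewrite /z0; case: ifP => SL; last first.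
    rewrite (_ : z S = 0) ?mul0mx ?mxE ?subrr; first exact: I_0.
    by apply/eqP; apply: contraFT SL => /sz.
  have := I_hproj (D - #|S|%:Z) (uI S); rewrite linearB /= (hproj_id _ (homz S)) eqxx.
  suff -> : hproj (D - #|S|%:Z) ((u S *m fr_aug F) 0 0) =
    ((\row_l hproj (D - #|S|%:Z - deg 0 l) (u S 0 l)) *m fr_aug F) 0 0 by [].
  rewrite !mxE linear_sum; apply: eq_bigr => l _; rewrite mxE.
  rewrite -(hprojM _ _ (gmfr_aug_homog resF l)); congr (hproj _ _); lia.
have hz0 : staged z0.
  move=> S; rewrite /z0; case: ifP => SL; last first.
    by split=> [k|]; rewrite ?eqxx // mxE; apply/homog_of_degP => m'; rewrite mcoeff0 eqxx.
  by split=> // k; rewrite mxE hproj_homog.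
have kos_aug (c : {set 'I_n} -> 'rV[R]_(fr_rank F 0)) S :
    (kosX c S *m fr_aug F) 0 0 = kosX (fun T => (c T *m fr_aug F) 0 0 : R^o) S.
  by rewrite -kosX_mulmx kosX_row.
have lift S : exists v, kosX z0 S = v *m fr_diff F 0.
  apply/(gmfr_exact0 resF); rewrite kos_aug.
  have -> : kosX (fun T => (z0 T *m fr_aug F) 0 0 : R^o) S = kosX z S +
      - kosX (fun T => z T - (z0 T *m fr_aug F) 0 0 : R^o) S.
    by rewrite /kosX kosB opprB addrC subrK.
  apply: I_add => //; rewrite -mulN1r; apply: I_mul; apply: I_sum => x _; exact: I_mul.
have [y [y' yE]] := staged_split hz0 lift.
exists (fun T => (y T *m fr_aug F) 0 0) => S; rewrite -kos_aug.
rewrite -[z S](subrK ((z0 S *m fr_aug F) 0 0)) -addrA; apply: I_add => //.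
have -> : (z0 S *m fr_aug F) 0 0 - (kosX y S *m fr_aug F) 0 0 =
    (y' S *m fr_diff F 0 *m fr_aug F) 0 0 by rewrite yE mulmxDl mxE addrAC subrr add0r.
by apply/(gmfr_exact0 resF); exists (y' S).
Qed.

End Staircase.

(** * Squarefree monomials and the closed neighborhood ideal *)

Section NeighborhoodIdeal.

Variables (K : fieldType) (n : nat).
Local Notation R := {mpoly K[n]}.
Implicit Types (S A : {set 'I_n}) (p q : R).

Definition mset A : 'X_{1..n} := [multinom (i \in A : nat) | i < n].

Lemma msetE A i : mset A i = (i \in A).
Proof. exact: mnmE. Qed.

Lemma mdeg_mset A : mdeg (mset A) = #|A|.
Proof. by rewrite mdegE -sum1_card [RHS]big_mkcond; apply: eq_bigr => i _; rewrite msetE; case: ifP. Qed.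

Variable e : rel 'I_n.

Lemma closed_nbhd_monE w : closed_nbhd_mon K e w = 'X_[mset (closed_nbhd e w)].
Proof.
rewrite /closed_nbhd_mon mpolyXE_id big_mkcond; apply: eq_bigr => i _.
by rewrite msetE; case: ifP; rewrite ?expr1 ?expr0.
Qed.

Local Notation NI := (closed_nbhd_ideal K e).

Lemma NI_add p q : NI p -> NI q -> NI (p + q).
Proof.
move=> [c ->] [d ->]; exists (fun i => c i + d i).
by rewrite -big_split; apply: eq_bigr => i _; rewrite mulrDl.
Qed.

Lemma NI_mul p q : NI q -> NI (p * q).
Proof.
move=> [c ->]; exists (fun i => p * c i).
by rewrite mulr_sumr; apply: eq_bigr => i _; rewrite mulrA.
Qed.

Lemma NI_hproj d p : NI p -> NI (hproj d p).
Proof.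
move=> [c ->]; exists (fun i => hproj (d - (mdeg (mset (closed_nbhd e i)))%:Z) (c i)).
rewrite linear_sum; apply: eq_bigr => i _; rewrite closed_nbhd_monE.
by rewrite -(hprojM _ _ (homog_of_degX _ _)) subrK.
Qed.

Lemma NI_mset w A : closed_nbhd e w \subset A -> NI ('X_[mset A]).
Proof.
move=> sub; rewrite (_ : mset A = (mset (A :\: closed_nbhd e w) + mset (closed_nbhd e w))%MM).
  rewrite mpolyXD -closed_nbhd_monE; apply: NI_mul.
  exists (fun i => (i == w)%:R); rewrite (bigD1 w) //= eqxx mul1r big1 ?addr0 // => i /negbTE->.
  by rewrite mul0r.
apply/mnmP => i; rewrite mnmDE !msetE !inE.
by have := subsetP sub i; rewrite !inE; case: orP => //= _; [move=> ->|rewrite addn0].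
Qed.

(** Every monomial of a member of the ideal is divisible by a generator, and a generator divides the
    squarefree monomial of [A] only if its closed neighborhood lies in [A]. *)
Lemma NI_mcoeff0 A p : (forall w, ~~ (closed_nbhd e w \subset A)) -> NI p -> p@_(mset A) = 0.
Proof.
move=> h [c ->]; rewrite raddf_sum big1 //= => w _.
apply/eqP; apply: contraNT (h w); rewrite closed_nbhd_monE -mcoeff_msupp.
move=> /msuppM_le/allpairsP[[m1 m2] /= [_]]; rewrite msuppX inE => /eqP-> mE.
apply/subsetP => i iw; have := congr1 (fun m : 'X_{1..n} => m i) mE.
by rewrite /= mnmDE !msetE iw; case: (i \in A) => //; lia.
Qed.

Lemma NI_0 : NI 0.
Proof. by exists (fun=> 0); rewrite big1 // => i _; rewrite mul0r. Qed.

Lemma mset_setU1 (x : 'I_n) A : x \notin A ->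
  (mset (~: A) - U_(x))%MM = mset (~: (x |: A)).
Proof.
move=> xA; apply/mnmP => i; rewrite mnmBE mnm1E !msetE !inE negb_or [x == i]eq_sym.
by case: (eqVneq i x) => [->|_]; rewrite ?subn0 // xA.
Qed.

Lemma mulX_mset (x : 'I_n) A : x \notin A ->
  'X_x * 'X_[mset (~: (x |: A))] = 'X_[mset (~: A)] :> R.
Proof.
move=> xA; rewrite -mset_setU1 // -mpolyXD addmC submK //.
by apply/mnm_lepP => i; rewrite mnm1E msetE !inE; case: eqP => // <-; rewrite xA.
Qed.

Lemma sign_mulE k p : (-1) ^+ k * p = (-1) ^+ k *: p.
Proof. by rewrite -!(signr_odd _ k); case: odd; rewrite ?mulN1r ?scaleN1r ?mul1r ?scale1r. Qed.

End NeighborhoodIdeal.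

(** * Low degrees: from the Koszul complex of R/NI to the bipartite double *)

Section Doubling.

Variables (K : fieldType) (n : nat).
Local Notation R := {mpoly K[n]}.
Local Notation U := ('I_n + 'I_n)%type.

(** On left vertices this is the order of ['I_n], so signs of left sets agree with the Koszul signs;
    the shift by [n] makes it injective. *)
Definition dbl_rank (u : U) : nat := match u with inl i => i | inr i => n + i end.

Lemma dbl_rank_inj : injective dbl_rank.
Proof.
move=> [i|i] [j|j] /= h.
- by rewrite (val_inj h).
- by have := ltn_ord i; rewrite h; lia.
- by have := ltn_ord j; rewrite -h; lia.
by congr inr; apply: val_inj; move: h => /eqP; rewrite eqn_add2l => /eqP.
Qed.

Lemma sgn_left (x : 'I_n) (T : {set 'I_n}) :
  sgn dbl_rank K (inl x) (parts T set0) = sgn (@nat_of_ord n) K x T.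
Proof.
rewrite /sgn; congr (_ ^+ _).
rewrite -(card_left [set y in T | (y < x)%N]); apply: eq_card => -[y|y]; by rewrite !inE.
Qed.

Lemma parts_setU1 (x : 'I_n) (T : {set 'I_n}) :
  parts (x |: T) set0 = inl x |: parts T set0.
Proof. by apply/setP => -[y|y]; rewrite !inE. Qed.

Lemma bd_left (c : {set U} -> K^o) (T : {set 'I_n}) :
  (forall y, c (inr y |: parts T set0) = 0) ->
  bd dbl_rank c (parts T set0) =
  \sum_(x | x \notin T) sgn (@nat_of_ord n) K x T * c (parts (x |: T) set0).
Proof.
move=> cr; rewrite /bd /kos big_sumType /= [X in _ + X]big1 ?addr0 => [|y _]; last first.
  by rewrite cr scaler0.
apply: eq_big => [x|x _]; first by rewrite in_parts.
by rewrite mul1r sgn_left -parts_setU1.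
Qed.

Variable e : rel 'I_n.
Hypothesis e_sym : symmetric e.
Local Notation r := (fun x y : 'I_n => (y == x) || e x y).
Local Notation NI := (closed_nbhd_ideal K e).

Lemma indep_left_right T (y : 'I_n) :
  indep (bip r) (inr y |: parts T set0) = [disjoint T & closed_nbhd e y].
Proof.
have nb u : (u \in closed_nbhd e y) = r u y by rewrite inE eq_sym e_sym.
apply/indepP/idP => [ind|/disjointFr dis [u|u] [v|v]].
- apply/pred0P => x; apply/negP => /= /andP[xT]; rewrite nb => h.
  have := ind (inl x) (inr y); rewrite !inE /= xT eqxx => /(_ isT isT) /=.
  by rewrite h.
- by rewrite !inE /= => _ _.
- by rewrite !inE /= orbF => /dis + /eqP[->]; rewrite nb /= => ->.
- by rewrite !inE /= orbF => /eqP[->] /dis; rewrite nb /= => ->.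
by [].
Qed.

(* Sending e_S to c_S X^{V \ S} maps chains to the Koszul complex of R / NI: for non-dominating
   S the monomial lies in NI.  The kernel is acyclic by [rel_cycle_boundary]. *)
Lemma low_cycle_boundary (F : free_complex K n) (L : nat) (c : {set U} -> K^o) :
  graded_min_free_resolution NI F -> (forall q, (q <= L)%N -> betti F q n%:Z = 0%N) ->
  chain_on (bip r) setT c -> bd dbl_rank c =1 (fun=> 0) ->
  (forall S, c S != 0 -> (#|S| <= L)%N) ->
  exists2 f, chain_on (bip r) setT f & c =1 bd dbl_rank f.
Proof.
move=> resF noB onc cyc sz.
have cr (T : {set 'I_n}) (y : 'I_n) : ~~ [disjoint T & closed_nbhd e y] -> c (inr y |: parts T set0) = 0.
  by move=> h; apply/eqP; apply: contraNT h => /onc/andP[_]; rewrite indep_left_right.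
pose z S : R^o := c (parts S set0) *: 'X_[mset (~: S)].
have [|||y yE] := kos_cycle_boundary resF (@NI_add _ _ e) (@NI_mul _ _ e) (@NI_hproj _ _ e) noB (z := z).
- move=> S; apply/homog_of_degP => m; rewrite /z mcoeffZ mcoeffX.
  case: (eqVneq (mset (~: S)) m) => [<- _|]; rewrite ?mulr0 ?eqxx // mdeg_mset.
  by have := cardsC S; rewrite card_ord; lia.
- move=> S zS; rewrite -(card_left S); apply: sz; apply: contra_neq zS => h.
  by rewrite /z h scale0r.
- move=> S; have zE : kosX z S =
      (\sum_(x | x \notin S) sgn (@nat_of_ord n) K x S * c (parts (x |: S) set0)) *: 'X_[mset (~: S)].
    rewrite scaler_suml; apply: eq_bigr => x xS.
    change ('X_x * sgn (@nat_of_ord n) R x S * (c (parts (x |: S) set0) *: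
      'X_[mset (~: (x |: S))]) = (sgn (@nat_of_ord n) K x S * c (parts (x |: S) set0)) *:
      'X_[mset (~: S)] :> R).
    by rewrite -mulrA sign_mulE -!scalerAr scalerA mulX_mset.
  (* If [S] meets every closed neighborhood, no right vertex extends it and the coefficient is a
     value of [bd c]. Otherwise a closed neighborhood lies in the complement of [S], and the
     monomial is in the ideal. *)
  rewrite zE; case: (boolP [forall w, ~~ [disjoint S & closed_nbhd e w]]) => [/forallP h|].
    rewrite -bd_left => [|w]; last exact: cr.
    by rewrite cyc scale0r -(mul0r (0 : R)); apply: NI_mul; exact: NI_0.
  rewrite negb_forall => /existsP[w]; rewrite negbK => h.
  rewrite -mul_mpolyC; apply: NI_mul; apply: (@NI_mset _ _ e w).
  by rewrite subsets_disjoint setCK disjoint_sym.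
pose left (S : {set U}) := [set x | inl x \in S].
have leftK T : left (parts T set0) = T by apply/setP => x; rewrite !inE.
(* Reads off from [y] the coefficients at the monomials used in [z], turning the Koszul filling back
   into a chain on left sets. *)
pose psi (S : {set U}) : K^o :=
  if S \subset parts setT set0 then (y (left S))@_(mset (~: left S)) else 0.
have psiN S : psi S != 0 -> S \subset parts setT set0.
  by rewrite /psi; case: ifP; rewrite ?eqxx.
have onpsi : chain_on (bip r) setT psi.
  by move=> S /psiN sub; rewrite subsetT (indepS sub (indep_left _ _)).
have psi_left T : psi (parts T set0) = (y T)@_(mset (~: T)).
  by rewrite /psi subset_parts ?subsetT // leftK.
(* Left sets covering the right copy are the dominating sets T. The complement of such T contains no
   closed neighborhood, so the ideal member [z T - kosX y T] has coefficient zero at that squarefree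
   monomial, and there [c] equals [bd dbl_rank psi]. *)
have [|||||f relf fE] := @rel_cycle_boundary K U dbl_rank dbl_rank_inj (bip r) (bip_sym _)
    (parts setT set0) (parts set0 setT) (fun S => c S - bd dbl_rank psi S).
- exact: disjoint_parts.
- exact: indep_left.
- exact: indep_right.
- move=> S ne; rewrite partsU.
  have -> : indep (bip r) S.
    move: ne => /add_neq0[/onc/andP[]//|]; rewrite oppr_eq0 => /bd_neq0[x _ /onpsi/andP[_]].
    by apply: indepS; apply: subsetUr.
  apply/andP; split; first by apply/subsetP => -[x|x] _; rewrite !inE.
  apply: contra ne => /andP[sub /coversP cov].
  have SE : S = parts (left S) set0.
    apply/setP => -[x|x]; rewrite !inE //; apply/negP => /(subsetP sub).
    by rewrite !inE.
  set T := left S in SE; rewrite SE in cov *.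
  rewrite bd_left => [|w]; last first.
    rewrite /psi; case: ifP => // /subsetP/(_ _ (setU11 _ _)); by rewrite !inE.
  have dom w : ~~ (closed_nbhd e w \subset ~: T).
    have [|[x|x]] := cov (inr w); rewrite ?inE //= => xT xw.
    apply/negP => /subsetP/(_ x); rewrite !inE xT /= => /(_ _)/negP; apply.
      by rewrite eq_sym e_sym xw.
    by [].
  have /eqP := NI_mcoeff0 dom (yE T); rewrite mcoeffB /z mcoeffZ mcoeffX eqxx mulr1.
  move/eqP/eqP; congr (_ - _ == 0).
  rewrite raddf_sum /=; apply: eq_bigr => x xT; rewrite psi_left.
  rewrite /GRing.scale /= -mulrA sign_mulE -scalerAr mcoeffZ mcoeffXM msetE inE xT /=.
  by rewrite mset_setU1.
- by move=> S; rewrite bdB bd_bd ?subr0; [exact: cyc|exact: dbl_rank_inj].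
exists (fun S => f S + psi S) => S; last by rewrite bdD -fE subrK.
move=> /add_neq0[/relf/and3P[_ -> _]|/onpsi/andP[_ ->]]; by rewrite subsetT.
Qed.

End Doubling.

(** * Matchings and the regularity bound *)

Lemma matching_numberP (T : finType) (e : rel T) :
  exists2 M, is_matching e M & #|M| = matching_number e.
Proof.
have [|M MM maxM] := @eq_bigmax_cond _ (is_matching e) (fun M : {set {set T}} => #|M|).
  2: by exists M; [exact: MM|exact: esym maxM].
apply/card_gt0P; exists set0; rewrite unfold_in /is_matching sub0set /=.
by apply/trivIsetP => A B; rewrite inE.
Qed.

Lemma matching_edge (T : finType) (e : rel T) (M : {set {set T}}) (P : {set T}) :
  symmetric e -> irreflexive e -> is_matching e M -> P \in M ->
  #|P| = 2 /\ {in P &, forall x y, (y == x) || e x y}.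
Proof.
move=> e_sym e_irr /andP[/subsetP sub _] /sub; rewrite inE => /existsP[x /existsP[y /andP[xy /eqP->]]].
split; first by rewrite cards2; case: eqVneq xy => // ->; rewrite e_irr.
by move=> u v; rewrite !inE => /orP[/eqP->|/eqP->] /orP[/eqP->|/eqP->]; rewrite ?eqxx ?xy ?orbT // e_sym xy orbT.
Qed.

Lemma card_matching (T : finType) (e : rel T) (M : {set {set T}}) :
  symmetric e -> irreflexive e -> is_matching e M -> (2 * #|M| <= #|T|)%N.
Proof.
move=> e_sym e_irr mM; have /andP[_ /eqP trivM] := mM.
apply: leq_trans (max_card (mem (cover M))); rewrite -trivM mulnC -sum_nat_const.
by apply: leq_sum => P /(matching_edge e_sym e_irr mM)[->].
Qed.

Theorem theorem1p2 (K : fieldType) (n : nat) (e : rel 'I_n)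
    (e_sym : symmetric e) (e_irr : irreflexive e) (r : int)
    (reg_r : is_regularity (closed_nbhd_ideal K e) r) :
  ((matching_number e)%:Z <= r)%R.
Proof.
have [F [resF _ reg_le]] := reg_r.
have [M mM <-] := matching_numberP e.
rewrite leNgt; apply/negP => r_lt.
have Mn := card_matching e_sym e_irr mM; rewrite card_ord in Mn.
have /andP[_ trivM] := mM.
(* A generator of degree [n] in position [q <= L] would force r >= n - q >= |M|. *)
pose L := (n - #|M|)%N.
have no_betti q : (q <= L)%N -> betti F q n%:Z = 0%N.
  move=> qL; apply/eqP; apply: contraT => /eqP/reg_le; rewrite /L in qL; lia.
apply: (@indep_complex_not_exact K 'I_n (fun x y => (y == x) || e x y) _ (@dbl_rank_inj n)).
- by move=> x; rewrite eqxx.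
- by move=> x y; rewrite eq_sym e_sym.
move=> c onc cyc.
(* The boundary lowers cardinality by one, so both truncations of a cycle are cycles. Sets in [hi]
   have more than n - |M| elements, which is the bound 2n < 2|S| + 2|M| for the full vertex sets. *)
pose lo (S : {set 'I_n + 'I_n}) : K^o := if (#|S| <= L)%N then c S else 0.
pose hi (S : {set 'I_n + 'I_n}) : K^o := if (#|S| <= L)%N then 0 else c S.
have cE S : c S = lo S + hi S by rewrite /lo /hi; case: ifP; rewrite ?addr0 ?add0r.
have loN S : lo S != 0 -> (#|S| <= L)%N /\ c S != 0 by rewrite /lo; case: ifP; rewrite ?eqxx.
have hiN S : hi S != 0 -> (L < #|S|)%N /\ c S != 0.
  by rewrite ltnNge /hi; case: ifP; rewrite ?eqxx.
have cyc_lo : bd (@dbl_rank n) lo =1 (fun=> 0).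
  move=> S; have [SL|SL] := ltnP #|S| L.
    rewrite -[RHS](cyc S); apply: eq_bigr => x xS.
    by rewrite /lo cardsU1 xS add1n SL.
  apply/eqP; apply: contraT => /bd_neq0[x xS /loN[]].
  by rewrite cardsU1 xS add1n ltnNge SL.
have cyc_hi : bd (@dbl_rank n) hi =1 (fun=> 0).
  by move=> S; rewrite -[LHS]add0r -{1}(cyc_lo S) -bdD -(eq_bd _ cE) cyc.
have [|||f1 onf1 f1E] := @low_cycle_boundary K n e e_sym F L lo resF no_betti.
- by move=> S /loN[_ /onc].
- exact: cyc_lo.
- by move=> S /loN[].
have partsT : parts setT setT = setT :> {set 'I_n + 'I_n}.
  by apply/setP => -[x|x]; rewrite !inE.
have [||||f2 onf2 f2E] := @disjoint_edges_boundary K 'I_n (fun x y => (y == x) || e x y) _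
    (@dbl_rank_inj n) M setT setT hi trivM.
- by move=> P /(matching_edge e_sym e_irr mM)[P2 Pe]; rewrite setIT subsetT.
- by move=> S /hiN[_ /onc]; rewrite partsT.
- exact: cyc_hi.
- move=> S /hiN[+ _]; rewrite cardsT card_ord /L ltn_subLR; last by lia.
  by rewrite -mulnDr addnn -mul2n ltn_pmul2l // addnC.
exists (fun S => f1 S + f2 S); last by move=> S; rewrite bdD -f1E -f2E -cE.
by move=> S /add_neq0[/onf1|/onf2] //; rewrite partsT.
Qed.
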